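(* Let $X$ be an infinite-dimensional Banach space and let $\Lambda\leq X$ be a non-cobounded lattice, and consider the Diophantine space $(X,\mathbb{Q}\Lambda,H_{\mathrm{std}})$. (i) For any $s\geq 0$, writing $\psi_s(q)=q^{-s}$, the Hausdorff dimension of $\mathrm{WA}_{\psi_s}$ is $+\infty$. (ii) Suppose that $\Lambda$ is not strongly discrete. Then for any nonincreasing function $\psi:(0,+\infty)\to(0,+\infty)$ with $\psi(q)\to 0$ as $q\to+\infty$, the Hausdorff dimension of $\mathrm{WA}_\psi$ is $+\infty$. In fact, for any nondecreasing function $f:(0,+\infty)\to(0,+\infty)$, $\mathcal{H}^f(\mathrm{WA}_\psi)=+\infty$.
   Context: Banach spaces are real. A lattice in a Banach space $X$ is a subgroup $\Lambda\leq X$ which is topologically discrete (equivalently $\min_{p\in\Lambda\setminus\{0\}}\|p\|>0$) and such that $\mathbb{R}\Lambda$ is dense in $X$, or equivalently, no proper closed subspace of $X$ contains $\Lambda$. $\Lambda$ is cobounded if its codiameter $\mathrm{codiam}(\Lambda):=\sup\{\mathrm{dist}(x,\Lambda):x\in X\}$ is finite, and non-cobounded otherwise. $\Lambda$ is strongly discrete if $\#(\Lambda\cap B(0,C))<+\infty$ for all $C>0$, where $B(0,C)$ is the ball of radius $C$ centered at $0$. $\mathbb{Q}\Lambda=\{p/q:p\in\Lambda,q\in\mathbb{N}\}$ with $\mathbb{N}=\{1,2,\ldots\}$, and $H_{\mathrm{std}}(r)=\min\{q\in\mathbb{N}:qr\in\Lambda\}$ for $r\in\mathbb{Q}\Lambda$.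 $\mathrm{BA}_\psi$ is the set of $x\in X$ for which there exists $\varepsilon>0$ such that $\|r-x\|\geq\varepsilon\,\psi(H_{\mathrm{std}}(r))$ for all $r\in\mathbb{Q}\Lambda$, and $\mathrm{WA}_\psi=X\setminus\mathrm{BA}_\psi$. $\mathcal{H}^f(S)$ denotes the Hausdorff $f$-measure (with gauge function $f$) of a set $S$. *)

(* Defs.v *)
From mathcomp Require Import all_boot all_order all_algebra.
From mathcomp Require Import all_classical all_reals all_analysis.
Import Order.TTheory GRing.Theory Num.Theory.
Import numFieldNormedType.Exports.

Set Implicit Arguments.
Unset Strict Implicit.
Unset Printing Implicit Defensive.

Local Open Scope classical_set_scope.
Local Open Scope ring_scope.

Definition lin_span (R : realType) (X : normedModType R) (A : set X) : set X :=
  [set x | exists n (a : 'I_n -> R) (v : 'I_n -> X),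
      (forall i, A (v i)) /\ x = \sum_(i < n) a i *: v i].

Definition infinite_dimensional (R : realType) (X : normedModType R) : Prop :=
  ~ exists2 B : set X, finite_set B & lin_span B = setT.

Record is_lattice (R : realType) (X : normedModType R) (L : set X) : Prop :=
  IsLattice {
    lattice0 : L 0;
    latticeB : forall p q, L p -> L q -> L (p - q);
    lattice_discrete : L `<=` isolated L;
    lattice_dense : dense (lin_span L) }.

Definition codiam (R : realType) (X : normedModType R) (L : set X) : \bar R :=
  ereal_sup [set edist_inf L x | x in [set: X]].

Definition cobounded (R : realType) (X : normedModType R) (L : set X) : Prop :=
  (codiam L < +oo)%E.

Definition strongly_discrete (R : realType) (X : normedModType R) (L : set X) :
    Prop :=
  forall C : R, 0 < C -> finite_set (L `&` ball 0 C).

Definition Qlat (R : realType) (X : normedModType R) (L : set X) : set X :=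
  [set r | exists p (q : nat), [/\ L p, (0 < q)%N & r = q%:R^-1 *: p]].

(* The value is 0 when [r] is not in [Qlat L]. *)
Definition Hstd (R : realType) (X : normedModType R) (L : set X) (r : X) : nat :=
  let denoms := [set q : nat | (0 < q)%N /\ L (q%:R *: r)] in
  xget 0%N [set q | denoms q /\ forall q', denoms q' -> (q <= q')%N].

(* [Q] is the set of rational points of a Diophantine space and [H] its height
   function; only the values of [psi] on positive reals are meaningful. *)
Definition BA (R : realType) (X : normedModType R) (Q : set X) (H : X -> nat)
    (psi : R -> R) : set X :=
  [set x | exists2 eps : R, 0 < eps &
     forall r, Q r -> eps * psi (H r)%:R <= `|r - x|].

Definition WA (R : realType) (X : normedModType R) (Q : set X) (H : X -> nat)
    (psi : R -> R) : set X :=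
  ~` BA Q H psi.

(* The diameter of the empty set is -oo here. *)
Definition ediam (R : realType) (X : normedModType R) (A : set X) : \bar R :=
  ereal_sup [set `|x - y|%:E | x in A & y in A].

(* f(diam A), for a gauge [f] defined on positive reals only: f(0) is read as
   f(0+), i.e. the infimum of f since f is nondecreasing, and the empty set has
   weight 0. With these conventions the gauge t |-> t `^ 0 gives the counting
   measure. *)
Definition gauge_diam (R : realType) (X : normedModType R) (f : R -> R)
    (A : set X) : \bar R :=
  if A == set0 then 0%E
  else if ediam A == 0%E then ereal_inf [set (f t)%:E | t in [set t | 0 < t]]
  else (f (fine (ediam A)))%:E.

Definition hausdorff_content (R : realType) (X : normedModType R) (f : R -> R)
    (delta : R) (S : set X) : \bar R :=
  ereal_inf [set (\sum_(0 <= i <oo) gauge_diam f (U i))%E |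
    U in [set U : nat -> set X |
            (forall i, (ediam (U i) <= delta%:E)%E) /\ S `<=` \bigcup_i U i]].

Definition hausdorff_measure (R : realType) (X : normedModType R) (f : R -> R)
    (S : set X) : \bar R :=
  ereal_sup [set hausdorff_content f delta S | delta in [set d : R | 0 < d]].

Definition hausdorff_dim (R : realType) (X : normedModType R) (S : set X) :
    \bar R :=
  ereal_inf [set s%:E | s in
    [set s : R | 0 <= s /\ hausdorff_measure (fun t => t `^ s) S = 0%E]].

(* Main.v *)
Require Import Defs.
From mathcomp Require Import all_boot all_order all_algebra.
From mathcomp Require Import all_classical all_reals all_analysis.
From mathcomp Require Import lra zify.
Import Order.TTheory GRing.Theory Num.Theory.
Import numFieldNormedType.Exports.

Set Implicit Arguments.
Unset Strict Implicit.
Unset Printing Implicit Defensive.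

Local Open Scope classical_set_scope.
Local Open Scope ring_scope.

(** The points produced below have the form x = sum_k e_k(a_k) / q_k, where the
    e_k(j), for j < N_k, are distinct vectors of L, the digit sequence a is
    free, and q_k divides q_(k+1).  If the tail of this series beyond the index
    k is much smaller than 1 / q_k, two things happen.  The partial sum up to k
    is a rational point of denominator q_k, extremely close to x, so x lies in
    WA.  And since distinct vectors of L are at distance at least lam > 0, two
    digit sequences that first differ at the place k give points at distance at
    least rho_k = lam / (2 q_k).  So WA contains a copy of the tree of all digit
    sequences, with N_k branches at every node of level k.

    On such a tree the mass distribution principle ([mass_distribution]) bounds
    the Hausdorff f-measure from below by any c with
    c <= f(rho_(k+1)) * N_k for all k.  It does not need compactness: given
    a cover of too small a weight, a branch that escapes from it is found
    greedily ([avoiding_branch]).  [hausdorff_WA_ge] puts this together and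
    leaves only the choice of e, q and N, which has to supply many vectors of L
    of controlled norm.

    - If L is not strongly discrete, some ball contains infinitely many vectors
      of L.  The denominators q_k are then chosen from psi alone, and the N_k
      afterwards, as large as f and c demand: every c is reached, whatever f is.

    - In general, L is not contained in a finite-dimensional subspace, because
      such a subspace is closed ([seq_span_closed]) and R L is dense.  Hence for
      every d there are M^d vectors of L of norm O(M) ([lattice_growth]).  With
      N_k = M_k^d the exponent d beats both the exponent s of psi and the
      dimension t under test, as soon as log M_(k+1) / log M_k is a large
      constant (depending on s) and d is large in terms of s and t. *)

(** * Branches of a tree that avoid words of small total mass *)

(** W n is the mass of every node of level n when a total mass W 0 is shared
    equally among children.  For a node u let the load of u be the sum of the
    masses of the forbidden words that extend u.  The loads of the children of u
    add up to at most the load of u, and their masses to the mass of u; so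
    a node whose load is smaller than its mass has a child with the same
    property.  The branch obtained by following such children meets no forbidden
    word, as a node equal to a forbidden word carries at least its own mass as
    load. *)
Lemma avoiding_branch (R : realType) (N : nat -> nat) (W : nat -> R)
    (k : nat -> nat) (w : nat -> nat -> nat) :
  (forall n, 0 < W n) -> (forall n, W n = (N n)%:R * W n.+1) ->
  (\sum_(0 <= i <oo) (W (k i))%:E < (W 0%N)%:E)%E ->
  exists a : nat -> nat, (forall n, (a n < N n)%N) /\
    forall i, ~ (forall j, (j < k i)%N -> a j = w i j).
Proof.
move=> W0 WS sumW.
pose below (u : seq nat) i :=
  (size u <= k i)%N && (u == mkseq (w i) (size u)).
pose load (u : seq nat) : \bar R :=
  (\sum_(0 <= i <oo) (if below u i then W (k i) else 0)%:E)%E.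
have term0 u i : (0 <= (if below u i then W (k i) else 0)%:E)%E.
  by rewrite lee_fin; case: ifP => // _; exact: ltW.
have loadS u : (load u < (W (size u))%:E)%E ->
    exists d, (d < N (size u))%N /\
      (load (rcons u d) < (W (size u).+1)%:E)%E.
  move=> loadu; apply: contrapT => nd.
  suff : ((W (size u))%:E <= load u)%E by rewrite leNgt loadu.
  have : (\sum_(d < N (size u)) (W (size u).+1)%:E <=
          \sum_(d < N (size u)) load (rcons u d))%E.
    apply: lee_sum => d _; rewrite leNgt; apply/negP => ld.
    by apply: nd; exists d; split.
  rewrite sumEFin sumr_const card_ord -mulr_natl -WS => /le_trans; apply.
  rewrite /load -nneseries_sum; last by move=> d j _; exact: term0.
  apply: lee_nneseries => [i _ _|i _]; first exact: sume_ge0.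
  rewrite sumEFin lee_fin.
  have [bu|nbu] := boolP (below u i); last first.
    rewrite big1// => d _; case: ifP => // /andP[]; rewrite size_rcons => kd.
    rewrite mkseqS eqseq_rcons => /andP[eu _].
    by case/negP: nbu; rewrite /below (ltnW kd).
  have [dN|Nd] := ltnP (w i (size u)) (N (size u)); last first.
    rewrite big1 ?(ltW (W0 _))// => d _; case: ifP => // /andP[_].
    rewrite size_rcons mkseqS eqseq_rcons => /andP[_ /eqP de].
    by move: (ltn_ord d); rewrite de ltnNge Nd.
  rewrite (bigD1 (Ordinal dN))//= big1 ?addr0.
    by case: ifP => // _; exact: ltW.
  move=> d; rewrite -val_eqE/= => dne; case: ifP => // /andP[_].
  by rewrite size_rcons mkseqS eqseq_rcons (negbTE dne) andbF.
pose g u := xget 0%N [set d | (d < N (size u))%N /\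
      (load (rcons u d) < (W (size u).+1)%:E)%E].
pose F := fix F n := if n is m.+1 then rcons (F m) (g (F m)) else [::].
have sF n : size (F n) = n by elim: n => //= n IH; rewrite size_rcons IH.
have FE n : F n = mkseq (fun j => g (F j)) n.
  by elim: n => // n IH; rewrite mkseqS -IH.
have loadF n : (load (F n) < (W n)%:E)%E.
  elim: n => [|n IH].
    apply: le_lt_trans sumW; apply: lee_nneseries => [i _ _|i _//].
    exact: (term0 [::]).
  have IH' : (load (F n) < (W (size (F n)))%:E)%E by rewrite sF.
  by have [_] := xgetPex 0%N (loadS _ IH'); rewrite -[xget _ _]/(g (F n)) sF.
exists (fun j => g (F j)); split=> [n|i ai].
  have loadn : (load (F n) < (W (size (F n)))%:E)%E by rewrite sF.
  by have [+ _] := xgetPex 0%N (loadS _ loadn); rewrite -[xget _ _]/(g (F n)) sF.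
suff : ((W (k i))%:E <= load (F (k i)))%E by rewrite leNgt loadF.
rewrite /load (nneseriesD1 (n := i))//.
rewrite ifT; last first.
  rewrite /below sF leqnn/= FE; apply/eqP/eq_in_map => j.
  by rewrite mem_iota => /andP[_ /ai].
by rewrite leeDl//; apply: nneseries_ge0 => j _ _; exact: term0.
Qed.

(** * A mass distribution principle for coded sets *)

Lemma ediam_ub (R : realType) (X : normedModType R) (U : set X) (x y : X) :
  U x -> U y -> (`|x - y|%:E <= ediam U)%E.
Proof. by move=> Ux Uy; apply: ereal_sup_ubound; exists x => //; exists y. Qed.

(** Finiteness of the diameter matters: the [fine] of an infinite diameter is
    0, where a gauge may take any value. *)
Lemma gauge_diam_ge0 (R : realType) (X : normedModType R) (f : R -> R)
    (U : set X) :
  (forall t, 0 < t -> 0 < f t) -> (ediam U < +oo)%E -> (0 <= gauge_diam f U)%E.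
Proof.
move=> f0 Ufin; rewrite /gauge_diam; case: ifPn => // /set0P[x Ux].
case: ifPn => [_|dU0].
  by apply: le_ereal_inf_tmp => _ [t t0 <-]; rewrite lee_fin ltW ?f0.
have dU : (0 < ediam U)%E.
  by rewrite lt_neqAle eq_sym dU0 (le_trans _ (ediam_ub Ux Ux))// lee_fin.
by rewrite lee_fin ltW// f0// fine_gt0// dU Ufin.
Qed.

Lemma gauge_diam_ge (R : realType) (X : normedModType R) (f : R -> R)
    (U : set X) (t : R) :
  (forall t1 t2, 0 < t1 -> t1 <= t2 -> f t1 <= f t2) ->
  0 < t -> (t%:E <= ediam U)%E -> (ediam U < +oo)%E ->
  ((f t)%:E <= gauge_diam f U)%E.
Proof.
move=> fM t0 tU Ufin.
have dU : (0 < ediam U)%E by rewrite (lt_le_trans _ tU)// lte_fin.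
have Ufn : ediam U \is a fin_num by rewrite gt0_fin_numE.
rewrite /gauge_diam ifF; last first.
  apply/negP => /eqP U0; move: dU; rewrite U0 /ediam.
  rewrite (_ : [set _ | _ in _ & _ in _] = set0) ?ereal_sup0//.
  by apply/seteqP; split=> // z [].
rewrite gt_eqF// lee_fin fM// -lee_fin fineK//.
Qed.

(** The digit tree carries the mass that gives W n = c / (N 0 * ... * N (n-1)) to
    each cylinder of level n.  If k is least with rho k <= diam U, all
    the points of U share their first k digits by separation, so U lies in one
    cylinder of level k, of mass W k <= c / N (k-1) <= f (rho k) <= f (diam U).
    If there is no such k, all the points of U share all their digits, and the
    level can be chosen so deep that the mass is below any prescribed error
    term.  Hence a cover of weight less than c blocks words of total mass less
    than c, and some branch avoids them all. *)
Lemma mass_distribution (R : realType) (X : normedModType R) (f : R -> R)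
    (S : set X) (N : nat -> nat) (pi : (nat -> nat) -> X) (rho : nat -> R)
    (c : R) :
  (forall t, 0 < t -> 0 < f t) ->
  (forall t1 t2, 0 < t1 -> t1 <= t2 -> f t1 <= f t2) ->
  0 < c -> (forall k, 0 < rho k) -> (forall k, 2 <= N k)%N ->
  (forall k, c <= f (rho k.+1) * (N k)%:R) ->
  (forall a, (forall n, (a n < N n)%N) -> S (pi a)) ->
  (forall a b k, (forall n, (a n < N n)%N) -> (forall n, (b n < N n)%N) ->
     (forall j, (j < k)%N -> a j = b j) -> a k <> b k ->
     rho k <= `|pi a - pi b|) ->
  (c%:E <= hausdorff_measure f S)%E.
Proof.
move=> f0 fM c0 rho0 N2 cN Spi sep.
pose P n := (\prod_(j < n) N j)%N.
have N0 n : (0 < N n)%N by rewrite (leq_trans _ (N2 n)).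
have PS n : P n.+1 = (P n * N n)%N by rewrite /P big_ord_recr.
have P2 n : (2 ^ n <= P n)%N.
  elim: n => [|n IH]; first by rewrite /P big_ord0.
  by rewrite PS expnSr leq_mul.
have P0 n : (0 < P n)%N by rewrite (leq_trans _ (P2 n))// expn_gt0.
pose W n : R := c / (P n)%:R.
have W0 n : 0 < W n by rewrite divr_gt0// ltr0n.
have WS n : W n = (N n)%:R * W n.+1.
  rewrite /W PS natrM invfM mulrCA; congr (_ * _).
  by rewrite mulrCA divff ?mulr1// pnatr_eq0 -lt0n.
have W00 : W 0%N = c by rewrite /W /P big_ord0 divr1.
have Wlt eta : 0 < eta -> exists k, W k <= eta.
  move=> eta0; exists (Num.bound (c / eta)).
  rewrite ler_pdivrMr ?ltr0n// mulrC -ler_pdivrMr//.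
  apply: ltW; apply: lt_le_trans (archi_boundP _) _.
    by rewrite divr_ge0// ltW.
  by rewrite ler_nat (leq_trans _ (P2 _))// ltnW// ltn_expl.
apply: (@le_trans _ _ (hausdorff_content f (rho 0%N / 2) S)); last first.
  by apply: ereal_sup_ubound; exists (rho 0%N / 2) => //=; rewrite divr_gt0.
apply: le_ereal_inf_tmp => _ [U [Udiam SU] <-].
have Ufin i : (ediam (U i) < +oo)%E.
  by rewrite (le_lt_trans (Udiam i))// ltry.
(* Each covering set is confined to a cylinder whose mass is at most the weight
   of the set, up to an error eta needed for sets of very small diameter. *)
have word i eta : 0 < eta -> exists kw : nat * (nat -> nat),
    ((W kw.1)%:E <= gauge_diam f (U i) + eta%:E)%E /\
    forall a, (forall n, (a n < N n)%N) -> U i (pi a) ->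
      forall j, (j < kw.1)%N -> a j = kw.2 j.
  move=> eta0.
  suff [k [Wk small]] : exists k,
      ((W k)%:E <= gauge_diam f (U i) + eta%:E)%E /\
      forall j, (j < k)%N -> (ediam (U i) < (rho j)%:E)%E.
    have [[b [bN Ub]]|none] := pselect (exists b,
        (forall n, (b n < N n)%N) /\ U i (pi b)); last first.
      by exists (k, id); split=> // a aN Ua; case: none; exists a.
    exists (k, b); split=> //= a aN Ua.
    elim/ltn_ind => j IH jk; apply: contrapT => abj.
    have := sep a b j aN bN (fun l lj => IH l lj (ltn_trans lj jk)) abj.
    apply/negP; rewrite -ltNge -lte_fin.
    exact: le_lt_trans (ediam_ub Ua Ub) (small j jk).
  have [K WK] := Wlt eta eta0.
  have gU0 := gauge_diam_ge0 f0 (Ufin i).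
  have [[j [jK rj]]|big] := pselect (exists j,
      (j < K)%N /\ ((rho j)%:E <= ediam (U i))%E); last first.
    exists K; split; first by rewrite (le_trans _ (leeDr _ gU0))// lee_fin.
    by move=> j jK; rewrite ltNge; apply/negP => rj; apply: big; exists j.
  have exj : exists j, ((rho j)%:E <= ediam (U i))%E by exists j.
  (* The least index is positive because the cover is finer than rho 0. *)
  case: (ex_minnP exj) => -[r0 _|k rk kmin].
    have := le_trans r0 (Udiam i); rewrite lee_fin leNgt => /negP[].
    by rewrite ltr_pdivrMr// ltr_pMr// ltr1n.
  exists k.+1; split; last first.
    move=> l lk; rewrite ltNge; apply/negP => /kmin.
    by rewrite leqNgt lk.
  rewrite -[X in (X <= _)%E]adde0; apply: leeD; last by rewrite lee_fin ltW.
  apply: le_trans (gauge_diam_ge fM (rho0 _) rk (Ufin i)).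
  rewrite lee_fin /W PS ler_pdivrMr ?ltr0n ?muln_gt0 ?P0 ?N0//.
  rewrite natrM mulrCA; apply: (le_trans (cN k)).
  by rewrite ler_peMl ?ler1n ?P0// mulr_ge0// ltW// f0 ?rho0//.
rewrite leNgt; apply/negP => sumU.
set s := (\sum_(0 <= i <oo) _)%E in sumU.
have s0 : (0 <= s)%E.
  by apply: nneseries_ge0 => i _ _; exact: gauge_diam_ge0.
have sfin : s \is a fin_num.
  by rewrite ge0_fin_numE// (lt_trans sumU)// ltry.
pose eps := (c - fine s) / 2.
have eps0 : 0 < eps.
  by rewrite divr_gt0// subr_gt0 -lte_fin fineK.
have eta0 i : 0 < eps / (2 ^ i.+1)%:R :> R.
  by rewrite divr_gt0// ltr0n expn_gt0.
have [kw kwP] := choice (fun i => word i _ (eta0 i)).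
have [|a [aN aw]] := @avoiding_branch _ N W (fun i => (kw i).1)
    (fun i => (kw i).2) W0 WS.
  rewrite W00; apply: (@le_lt_trans _ _ (s + eps%:E)%E).
    apply: le_trans (epsilon_trick xpredT _ (ltW eps0)); last first.
      by move=> i; exact: gauge_diam_ge0.
    apply: lee_nneseries => [i _ _|i _]; first by rewrite lee_fin ltW.
    exact: (kwP i).1.
  rewrite -(fineK sfin) -EFinD lte_fin /eps.
  have : fine s < c by rewrite -lte_fin fineK.
  lra.
have [i _ Ui] := SU _ (Spi a aN).
exact: (aw i) ((kwP i).2 a aN Ui).
Qed.

(** * Rational points with respect to a lattice *)

(** The bound [2 * u n - 2 * u (n + p)] on a block of terms telescopes, which gives
    absolute convergence and the bound on the tail at the same time. *)
Lemma halving_series (R : realType) (X : completeNormedModType R)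
    (v : nat -> X) (u : nat -> R) :
  (forall k, `|v k| <= u k) -> (forall k, 2 * u k.+1 <= u k) ->
  exists x, forall n, `|x - \sum_(k < n) v k| <= 2 * u n.
Proof.
move=> vu uS.
have u0 k : 0 <= u k by exact: le_trans (vu k).
have telescope n p : \sum_(n <= k < n + p) `|v k| <= 2 * u n - 2 * u (n + p)%N.
  elim: p => [|p IH]; first by rewrite addn0 big_geq// subrr.
  rewrite addnS big_nat_recr ?leq_addr//=.
  have := vu (n + p)%N; have := uS (n + p)%N; lra.
have cvv : cvgn (series v).
  apply: normed_cvg; apply: nondecreasing_is_cvgn.
    apply/nondecreasing_seqP => n; rewrite -[leRHS]/(series (fun k => `|v k|) n.+1).
    by rewrite seriesSr lerDl.
  exists (2 * u 0%N) => _ [n _ <-] /=; apply: (le_trans (telescope 0%N n)).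
  by rewrite lerBlDr lerDl mulr_ge0 ?u0.
exists (limn (series v)) => n.
have cd : `|series v m - series v n| @[m --> \oo] -->
    `|limn (series v) - series v n|.
  by apply: cvg_norm; apply: cvgB => //; exact: cvg_cst.
rewrite -(big_mkord xpredT v) -[X in `|_ - X|]/(series v n) -(cvg_lim _ cd)//.
apply: limr_le; first by apply/cvg_ex; eexists; exact: cd.
exists n => // m /= nm; rewrite -(subnKC nm) sub_series_geq ?leq_addr//.
apply: (le_trans (ler_norm_sum _ _ _)); apply: (le_trans (telescope _ _)).
by rewrite lerBlDr lerDl mulr_ge0 ?u0.
Qed.

Lemma lattice_separated (R : realType) (X : normedModType R) (L : set X) :
  is_lattice L -> exists2 lam : R, 0 < lam &
    forall p, L p -> p != 0 -> lam <= `|p|.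
Proof.
move=> [L0 _ Liso _]; have [_ [V V0 VL]] := Liso 0 L0.
have [lam /= lam0 ballV] := nbhs_norm0P.1 V0.
exists lam => // p Lp p0; rewrite leNgt; apply/negP => plam.
have : (V `&` L) p by split=> //; exact: ballV.
by rewrite VL => /eqP; rewrite (negbTE p0).
Qed.

Lemma latticeD (R : realType) (X : normedModType R) (L : set X) (p q : X) :
  is_lattice L -> L p -> L q -> L (p + q).
Proof.
move=> LL Lp Lq; rewrite -[q]opprK; apply: (latticeB LL) => //.
by rewrite -sub0r; apply: (latticeB LL) => //; exact: (lattice0 LL).
Qed.

Lemma latticeMn (R : realType) (X : normedModType R) (L : set X) (p : X) n :
  is_lattice L -> L p -> L (n%:R *: p).
Proof.
move=> LL Lp; rewrite scaler_nat; elim: n => [|n IH].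
  by rewrite mulr0n; exact: (lattice0 LL).
by rewrite mulrS; exact: latticeD.
Qed.

Lemma Hstd_bounds (R : realType) (X : normedModType R) (L : set X) (r : X)
    (q : nat) :
  (0 < q)%N -> L (q%:R *: r) -> (0 < Hstd L r <= q)%N.
Proof.
move=> q0 Lqr; pose D n := `[< (0 < n)%N /\ L (n%:R *: r) >].
have exD : exists n, D n by exists q; apply/asboolP.
have [m /asboolP Dm mmin] := ex_minnP exD.
have ex : exists m, (0 < m)%N /\ L (m%:R *: r) /\
    forall n, (0 < n)%N /\ L (n%:R *: r) -> (m <= n)%N.
  by exists m; case: Dm => m0 Lm; do 2 split=> //; move=> n Dn; apply/mmin/asboolP.
rewrite /Hstd; case: xgetP => [_ -> [[-> _] /(_ q)]|/(_ m) []].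
  by apply; split.
by split=> // n Dn; apply/mmin/asboolP.
Qed.

(** A denominator q of r may be used in place of the height of r: the height is
    at most q, and psi is nonincreasing. *)
Lemma WA_approx (R : realType) (X : normedModType R) (L : set X)
    (psi : R -> R) (x : X) :
  (forall q, 0 < q -> 0 < psi q) ->
  (forall q1 q2, 0 < q1 -> q1 <= q2 -> psi q2 <= psi q1) ->
  (forall n, exists (q : nat) r, [/\ (0 < q)%N, L (q%:R *: r) &
     `|x - r| < psi q%:R / n.+1%:R]) ->
  WA (Qlat L) (Hstd L) psi x.
Proof.
move=> psi0 psiM approx [eps eps0 bad].
have [n neps] : exists n, n.+1%:R^-1 <= eps.
  exists (Num.bound eps^-1); rewrite invf_ple ?posrE ?ltr0n//.
  apply: ltW; apply: lt_le_trans (archi_boundP _) _; first by rewrite invr_ge0 ltW.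
  by rewrite ler_nat.
have [q [r [q0 Lqr xr]]] := approx n.
have Qr : Qlat L r.
  exists (q%:R *: r), q; split=> //.
  by rewrite scalerA mulVf ?scale1r// pnatr_eq0 -lt0n.
have /andP[H0 Hq] := Hstd_bounds q0 Lqr.
have := bad r Qr; apply/negP; rewrite -ltNge distrC (lt_le_trans xr)//.
rewrite mulrC; apply: ler_pM => //; rewrite ?invr_ge0//.
  by rewrite ltW// psi0// ltr0n.
by apply: psiM; rewrite ?ltr0n ?ler_nat.
Qed.

(** * Hausdorff measure of sets of well approximable points *)

(** Since E k >= lam, the bound on [E k.+1 / q k.+1] makes the terms
    of the series decay geometrically.  At a place k where two digit sequences
    first differ, the terms of index k are lam / q k apart, and the two tails
    change this by at most 4 * E k.+1 / q k.+1, that is, by at most half. *)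
Lemma hausdorff_WA_ge (R : realType) (X : completeNormedModType R) (L : set X)
    (psi f : R -> R) (lam c : R) (q N : nat -> nat) (e : nat -> nat -> X)
    (E : nat -> R) :
  is_lattice L ->
  (forall t, 0 < t -> 0 < psi t) ->
  (forall t1 t2, 0 < t1 -> t1 <= t2 -> psi t2 <= psi t1) ->
  (forall t, 0 < t -> 0 < f t) ->
  (forall t1 t2, 0 < t1 -> t1 <= t2 -> f t1 <= f t2) ->
  0 < lam -> (forall p, L p -> p != 0 -> lam <= `|p|) ->
  (forall k, 0 < q k)%N -> (forall k, q k %| q k.+1)%N ->
  (forall k, 2 <= N k)%N ->
  (forall k j, (j < N k)%N -> L (e k j) /\ `|e k j| <= E k) ->
  (forall k i j, (i < N k)%N -> (j < N k)%N -> e k i = e k j -> i = j) ->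
  (forall k, lam <= E k) ->
  (forall k, 8 * (E k.+1 / (q k.+1)%:R) <= lam / (q k)%:R) ->
  (forall k, 2 * (E k.+1 / (q k.+1)%:R) < psi (q k)%:R / k.+1%:R) ->
  0 < c -> (forall k, c <= f (lam / 2 / (q k.+1)%:R) * (N k)%:R) ->
  (c%:E <= hausdorff_measure f (WA (Qlat L) (Hstd L) psi))%E.
Proof.
move=> LL psi0 psiM f0 fM lam0 Lsep q0 qdvd N2 eLE einj lamE Elam Epsi c0 cN.
pose u k := E k / (q k)%:R.
have qR0 k : 0 < (q k)%:R :> R by rewrite ltr0n.
have u0 k : 0 < u k by rewrite divr_gt0// (lt_le_trans lam0).
have uS k : 2 * u k.+1 <= u k.
  have lu : lam / (q k)%:R <= u k by rewrite ler_pM2r ?invr_gt0.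
  by have := Elam k; have := u0 k.+1; rewrite /u in lu *; lra.
pose v (a : nat -> nat) k := (q k)%:R^-1 *: e k (a k).
pose psum a n := \sum_(k < n) v a k.
have code a : exists x, (forall n, (a n < N n)%N) ->
    forall n, `|x - psum a n| <= 2 * u n.
  have [aN|naN] := pselect (forall n, (a n < N n)%N); last by exists 0.
  have [k|x xP] := @halving_series _ _ (v a) u _ uS; last by exists x.
  rewrite normrZ ger0_norm ?invr_ge0// mulrC ler_pM2r ?invr_gt0//.
  by have [] := eLE k (a k) (aN k).
have [pi piP] := choice code.
have Lpsum a n : (forall n, (a n < N n)%N) -> L ((q n)%:R *: psum a n.+1).
  move=> aN; rewrite scaler_sumr.
  elim/big_ind : _ => [|x y|[k kn] _]; first exact: (lattice0 LL).
    exact: latticeD.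
  have /dvdnP[m ->] : (q k %| q n)%N.
    move: kn; rewrite ltnS /= => /subnKC <-.
    elim: (n - k)%N => [|p IH]; first by rewrite addn0.
    by rewrite addnS; exact: dvdn_trans (qdvd _).
  rewrite /v/= natrM scalerA mulfK ?gt_eqF//.
  by apply: latticeMn => //; have [] := eLE k (a k) (aN k).
apply: (@mass_distribution _ _ _ _ N pi (fun k => lam / 2 / (q k)%:R)) => //.
- by move=> k; rewrite !divr_gt0.
- move=> a aN; apply: WA_approx => // n.
  exists (q n), (psum a n.+1); split=> //; first exact: Lpsum.
  exact: le_lt_trans (piP a aN _) (Epsi n).
move=> a b k aN bN abk abk'.
have dpsum : psum a k.+1 - psum b k.+1 =
    (q k)%:R^-1 *: (e k (a k) - e k (b k)).
  rewrite /psum !big_ord_recr/= (eq_bigr (fun i : 'I_k => v b i)).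
    by rewrite opprD addrACA subrr add0r /v -scalerBr.
  by move=> [j jk] _; rewrite /v/= abk.
have -> : pi a - pi b = (psum a k.+1 - psum b k.+1)
    + ((pi a - psum a k.+1) - (pi b - psum b k.+1)).
  rewrite [in RHS]opprB [RHS]addrC -addrA [X in _ = _ + X]addrC.
  by rewrite !subrKA.
rewrite dpsum.
have [Lea _] := eLE k _ (aN k); have [Leb _] := eLE k _ (bN k).
(* Distinct vectors of L are lam apart. *)
have big : lam / (q k)%:R <= `|(q k)%:R^-1 *: (e k (a k) - e k (b k))|.
  rewrite normrZ ger0_norm ?invr_ge0// mulrC ler_pM2l ?invr_gt0//.
  apply: Lsep; first exact: (latticeB LL).
  by rewrite subr_eq0; apply/eqP => /(einj _ _ _ (aN k) (bN k)).
have small := ler_normB (pi a - psum a k.+1) (pi b - psum b k.+1).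
have := piP a aN k.+1; have := piP b bN k.+1; have := Elam k.
rewrite -/(u k.+1) mulrAC => E1 E2 E3.
apply: le_trans (lerB_normD _ _).
lra.
Qed.

(** * Lattices that are not strongly discrete *)

(** Infinitely many vectors of L in one ball allow the number of branches to be
    increased without changing the norms, hence without changing the
    denominators. *)
Lemma hausdorff_WA_not_strongly_discrete (R : realType)
    (X : completeNormedModType R) (L : set X) (psi f : R -> R) :
  is_lattice L -> ~ strongly_discrete L ->
  (forall t, 0 < t -> 0 < psi t) ->
  (forall t1 t2, 0 < t1 -> t1 <= t2 -> psi t2 <= psi t1) ->
  (forall t, 0 < t -> 0 < f t) ->
  (forall t1 t2, 0 < t1 -> t1 <= t2 -> f t1 <= f t2) ->
  hausdorff_measure f (WA (Qlat L) (Hstd L) psi) = +oo%E.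
Proof.
move=> LL Lnsd psi0 psiM f0 fM.
have [lam lam0 Lsep] := lattice_separated LL.
have [C [C0 Cinf]] : exists C, 0 < C /\ infinite_set (L `&` ball 0 C).
  by apply: contrapT => nC; apply: Lnsd => C C0; apply: contrapT => inf;
     apply: nC; exists C.
have [e [eD einj]] : exists e : nat -> X,
    (forall j, (L `&` ball 0 C) (e j)) /\ forall i j, e i = e j -> i = j.
  have /infiniteP/pcard_leP/unsquash e := Cinf.
  exists e; split=> [j|i j /inj]; first exact: funS.
  by apply; rewrite in_setT.
have eLC j : L (e j) /\ `|e j| < C.
  by case: (eD j) => Lj; rewrite -ball_normE /= sub0r normrN.
pose E := C + lam.
have E0 : 0 < E by rewrite addr_gt0.
have step (kq : nat * nat) : exists q', (0 < kq.2)%N ->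
    [/\ (0 < q')%N, (kq.2 %| q')%N, 8 * (E / q'%:R) <= lam / kq.2%:R
      & 2 * (E / q'%:R) < psi kq.2%:R / kq.1.+1%:R].
  case: kq => k q /=; have [q0|] := posnP q; first by exists 0%N.
  move=> q0; have qR0 : 0 < q%:R :> R by rewrite ltr0n.
  pose eps := Num.min (lam / q%:R / 8) (psi q%:R / k.+1%:R / 4).
  have p0 : 0 < psi q%:R / k.+1%:R by rewrite divr_gt0 ?psi0.
  have eps0 : 0 < eps.
    by rewrite lt_min !divr_gt0//= psi0.
  exists (q * (Num.bound (E / eps)).+1)%N => _.
  have small : E / (q * (Num.bound (E / eps)).+1)%:R <= eps.
    rewrite ler_pdivrMr ?ltr0n ?muln_gt0 ?q0// mulrC -ler_pdivrMr//.
    apply/ltW/(lt_le_trans (archi_boundP _)); first by rewrite divr_ge0// ltW.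
    by rewrite ler_nat; apply: leq_trans (leq_pmull _ q0).
  have := small; rewrite le_min => /andP[s1 s2].
  move: s1 s2 p0; set x := E / _; set y := lam / _; set z := psi _ / _.
  by move=> s1 s2 z0; split; [rewrite muln_gt0 q0|rewrite dvdn_mulr|lra|lra].
have [next nextP] := choice step.
pose q := fix q k := if k is k'.+1 then next (k', q k') else 1%N.
have q0 k : (0 < q k)%N by elim: k => //= k IH; have [] := nextP (k, q k) IH.
have fq0 k : 0 < f (lam / 2 / (q k.+1)%:R) by rewrite f0// !divr_gt0// ltr0n.
suff ge c : 0 < c -> (c%:E <= hausdorff_measure f (WA (Qlat L) (Hstd L) psi))%E.
  apply/eqyP => c c0; exact: ge.
move=> c0.
(* The denominators, hence the separations, are already fixed here; only the
   numbers of branches depend on c. *)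
pose N k := maxn 2 (Num.bound (c / f (lam / 2 / (q k.+1)%:R))).
apply: (@hausdorff_WA_ge _ _ _ _ _ lam _ q N (fun=> e) (fun=> E)) => //.
- by move=> k; have [] := nextP (k, q k) (q0 k).
- by move=> k; exact: leq_maxl.
- move=> k j _; have [Lj jC] := eLC j; split=> //.
  by rewrite ltW// (lt_le_trans jC)// lerDl ltW.
- by move=> k i j _ _; exact: einj.
- by move=> _; rewrite lerDr ltW.
- by move=> k; have [] := nextP (k, q k) (q0 k).
- by move=> k; have [] := nextP (k, q k) (q0 k).
move=> k; rewrite mulrC -ler_pdivrMr//.
apply/ltW/(lt_le_trans (archi_boundP _)); first by rewrite divr_ge0// ltW.
by rewrite ler_nat leq_maxr.
Qed.

(** * Finite-dimensional subspaces are closed *)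

(** Adding the generators one at a time is what makes closedness provable by
    induction. *)
Fixpoint seq_span (R : realType) (X : normedModType R) (s : seq X) : set X :=
  if s is v :: s' then [set x | exists a : R, seq_span s' (x - a *: v)]
  else [set 0].

Section SeqSpan.
Context (R : realType) (X : normedModType R).
Implicit Types (s : seq X) (x y v : X).

Lemma seq_span_linear s (a : R) x y :
  seq_span s x -> seq_span s y -> seq_span s (a *: x + y).
Proof.
elim: s x y => [|v s IH] x y /=; first by move=> -> ->; rewrite scaler0 addr0.
move=> [b xb] [c yc]; exists (a * b + c).
rewrite (_ : _ - _ = a *: (x - b *: v) + (y - c *: v)); first exact: IH.
by rewrite scalerBr scalerDl scalerA opprD addrACA.
Qed.

Lemma seq_span0 s : seq_span s 0.
Proof. by elim: s => //= v s IH; exists 0; rewrite scale0r subr0. Qed.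

Lemma seq_spanZ s (a : R) x : seq_span s x -> seq_span s (a *: x).
Proof.
by move=> sx; rewrite -[_ *: x]addr0; apply: seq_span_linear => //;
  exact: seq_span0.
Qed.

Lemma seq_spanD s x y : seq_span s x -> seq_span s y -> seq_span s (x + y).
Proof. by rewrite -{2}[x]scale1r; exact: seq_span_linear. Qed.

Lemma seq_spanB s x y : seq_span s x -> seq_span s y -> seq_span s (x - y).
Proof.
by move=> sx sy; rewrite addrC -scaleN1r; exact: seq_span_linear.
Qed.

Lemma seq_span_lin_span s : seq_span s `<=` lin_span [set` s].
Proof.
elim: s => [|v s IH] x /=.
  by move=> ->; exists 0%N, (fun=> 0), (fun=> 0); split=> [[]|]; rewrite ?big_ord0.
move=> [a /IH[n [b [w [sw xE]]]]].
exists n.+1, (fun i => oapp b a (unlift ord0 i)),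
  (fun i => oapp w v (unlift ord0 i)); split=> [i|].
  case: unliftP => [j|] _ /=; last by rewrite inE eqxx.
  by rewrite inE; apply/orP; right; exact: sw.
rewrite big_ord_recl unlift_none/= -(subrK (a *: v) x) xE addrC; congr (_ + _).
by apply: eq_bigr => i _; rewrite liftK.
Qed.

Lemma lin_span_seq_span (L : set X) s :
  L `<=` seq_span s -> lin_span L `<=` seq_span s.
Proof.
move=> Ls x [n [a [v [Lv ->]]]]; elim/big_ind: _ => [|y z|i _].
- exact: seq_span0.
- exact: seq_spanD.
- by apply: seq_spanZ; apply: Ls.
Qed.

(** When v is at distance d > 0 from the closed subspace Y spanned so far, the
    coefficient of v in an element z of Y + R v is bounded by |z| / d.  So the
    coefficients along a convergent sequence of Y + R v are Cauchy, and
    subtracting their limit leaves a convergent sequence of Y. *)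
Lemma seq_span_closed s : closed (seq_span s).
Proof.
elim: s => [|v s IH] /=.
  exact: accessible_closed_set1 (hausdorff_accessible (@norm_hausdorff _ X)) _.
have [sv|nsv] := pselect (seq_span s v).
  rewrite (_ : [set x | _] = seq_span s)//; apply/seteqP; split=> [x [a xa]|x sx].
    by rewrite -(subrK (a *: v) x); apply: seq_spanD => //; exact: seq_spanZ.
  by exists 0; rewrite scale0r subr0.
have [d d0 dv] : exists2 d : R, 0 < d & forall y, seq_span s y -> d <= `|v - y|.
  have : nbhs v (~` seq_span s) by apply: open_nbhs_nbhs; split; [exact: closed_openC|].
  move=> /nbhs_ballP[d /= d0 dP]; exists d => // y sy.
  rewrite leNgt; apply/negP => vy; apply: (dP y) sy.
  by rewrite -ball_normE.
have coef (a : R) y : seq_span s (y - a *: v) -> `|a| * d <= `|y|.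
  move=> sy; have [->|a0] := eqVneq a 0; first by rewrite normr0 mul0r.
  have := dv (- (a^-1 *: (y - a *: v))); rewrite -scaleNr => /(_ (seq_spanZ _ sy)).
  rewrite scaleNr opprK scalerBr scalerA mulVf// scale1r addrC subrK normrZ normfV.
  by rewrite ler_pdivlMl ?normr_gt0.
move=> x clx.
have approx n : exists ya : X * R,
    seq_span s (ya.1 - ya.2 *: v) /\ `|x - ya.1| < n.+1%:R^-1.
  have n0 : 0 < n.+1%:R^-1 :> R by rewrite invr_gt0.
  have [y [[a sy]]] := clx _ (nbhsx_ballx x _ n0).
  by rewrite -ball_normE /= => xy; exists (y, a).
have [yP ya] := choice approx.
have cy : (yP n).1 @[n --> \oo] --> x.
  apply/cvgrPdist_lt => eps eps0; near=> n.
  apply: lt_trans (ya n).2 _; near: n; exact: near_infty_natSinv_lt (PosNum eps0).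
have : cvg ((yP n).2 @[n --> \oo]).
  apply/cauchy_cvgP/cauchy_ballP => eps eps0.
  have e2 : 0 < eps * d / 2 by rewrite divr_gt0// mulr_gt0.
  have [K _ KP] := near_infty_natSinv_lt (PosNum e2).
  pose A := (fun n => (yP n).2) @` [set n | (K <= n)%N].
  have FA : ((yP n).2 @[n --> \oo]) A.
    by exists K => // n Kn; exists n.
  exists (A, A) => // -[_ _] /= [[n Kn <-] [m Km <-]].
  rewrite -ball_normE /=.
  have := coef ((yP n).2 - (yP m).2) ((yP n).1 - (yP m).1).
  have [syn xyn] := ya n; have [sym xym] := ya m.
  have -> : (yP n).1 - (yP m).1 - ((yP n).2 - (yP m).2) *: v =
      ((yP n).1 - (yP n).2 *: v) - ((yP m).1 - (yP m).2 *: v).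
    by rewrite scalerBl !opprD !opprK addrACA.
  move=> /(_ (seq_spanB syn sym)) le.
  have nm : `|(yP n).1 - (yP m).1| < eps * d.
    rewrite (le_lt_trans (ler_distD x _ _))// [X in X + _]distrC.
    rewrite (splitr (eps * d)) ltrD//.
      exact: lt_trans xyn (KP n Kn).
    exact: lt_trans xym (KP m Km).
  by rewrite -(ltr_pM2r d0); exact: le_lt_trans nm.
move=> /cvg_ex[a ca]; exists a.
have lim : (yP n).1 - (yP n).2 *: v @[n --> \oo] --> x - a *: v.
  by apply: cvgB => //; apply: cvgZr_tmp; exact: ca.
apply: (closed_cvg _ IH _ _ lim).
by apply: nearW => n; exact: (ya n).1.
Unshelve. all: by end_near.
Qed.

End SeqSpan.

(** * Approximation of polynomial order in infinite dimension *)

Lemma lattice_escapes_seq_span (R : realType) (X : normedModType R)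
    (L : set X) (s : seq X) :
  infinite_dimensional X -> is_lattice L -> exists2 v, L v & ~ seq_span s v.
Proof.
move=> Xinf LL; apply: contrapT => none; apply: Xinf.
have Ls : L `<=` seq_span s.
  by move=> v Lv; apply: contrapT => nsv; apply: none; exists v.
exists [set` s]; first exact: finite_seq.
apply/seteqP; split=> // x _; apply: seq_span_lin_span.
apply: contrapT => nsx.
have [] := lattice_dense LL (O := ~` seq_span s); first by exists x.
  by apply: closed_openC; exact: seq_span_closed.
by move=> y [+ /(lin_span_seq_span Ls)].
Qed.

(** The vectors are sum_(i < d) a_i v_i with 0 <= a_i < M, where each v_i in L is
    outside the span of the preceding ones; j encodes the coefficients by its
    digits in base M.  The span of the vectors used so far is part of the
    induction, since it is what the next vector must avoid. *)
Lemma lattice_growth (R : realType) (X : normedModType R) (L : set X) (d : nat) :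
  infinite_dimensional X -> is_lattice L ->
  exists2 D : R, 0 < D & forall M, (0 < M)%N -> exists g : nat -> X,
    (forall j, (j < M ^ d)%N -> L (g j) /\ `|g j| <= D * M%:R) /\
    (forall i j, (i < M ^ d)%N -> (j < M ^ d)%N -> g i = g j -> i = j).
Proof.
move=> Xinf LL.
suff [s [D [D0 gP]]] : exists s D, 0 < D /\ forall M, (0 < M)%N ->
    exists g : nat -> X,
    (forall j, (j < M ^ d)%N -> [/\ L (g j), seq_span s (g j) & `|g j| <= D * M%:R]) /\
    (forall i j, (i < M ^ d)%N -> (j < M ^ d)%N -> g i = g j -> i = j).
  exists D => // M M0; have [g [gL ginj]] := gP M M0; exists g; split=> //.
  by move=> j jM; have [] := gL j jM.
elim: d => [|d [s [D [D0 gP]]]].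
  exists [::], 1; split=> // M M0; exists (fun=> 0); split=> [j _|].
    by rewrite normr0 mul1r; split=> //; exact: lattice0.
  by move=> [|i] [|j]; rewrite expn0 ?ltnS.
have [v Lv nsv] := lattice_escapes_seq_span s Xinf LL.
exists (v :: s), (D + `|v|); split; first by rewrite ltr_wpDr.
move=> M M0; have [g [gL ginj]] := gP M M0.
have K0 : (0 < M ^ d)%N by rewrite expn_gt0 M0.
have modK j : (j %% M ^ d < M ^ d)%N by rewrite ltn_mod.
exists (fun j => g (j %% M ^ d)%N + (j %/ M ^ d)%:R *: v); split.
  move=> j jM; have [Lg sg gD] := gL _ (modK j).
  split; [|by exists (j %/ M ^ d)%:R; rewrite addrK|].
    by apply: latticeD => //; exact: latticeMn.
  rewrite (le_trans (ler_normD _ _))// mulrDl lerD// normrZ mulrC normr_nat.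
  by rewrite ler_wpM2l// ler_nat ltnW// ltn_divLR// -expnS.
move=> i j iM jM gij.
have [_ sgi _] := gL _ (modK i); have [_ sgj _] := gL _ (modK j).
have qij : (i %/ M ^ d = j %/ M ^ d)%N.
  apply/eqP; apply: contrapT => /negP ne; apply: nsv.
  set a : R := (i %/ M ^ d)%:R; set b : R := (j %/ M ^ d)%:R.
  have ab : b - a != 0 by rewrite subr_eq0 eq_sym eqr_nat.
  rewrite -[v](scalerK ab) scalerBl; apply: seq_spanZ.
  rewrite (_ : _ - _ = g (i %% M ^ d)%N - g (j %% M ^ d)%N).
    exact: seq_spanB.
  apply: (addIr (a *: v)); rewrite subrK [RHS]addrAC gij.
  by rewrite addrAC subrr add0r.
rewrite (divn_eq i (M ^ d)) (divn_eq j (M ^ d)) qij; congr (_ + _)%N.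
by apply: ginj => //; move: gij; rewrite qij => /addIr.
Qed.

Lemma hausdorff_dim_pinfty (R : realType) (X : normedModType R) (S : set X) :
  (forall t : R, 0 <= t ->
     (0 < hausdorff_measure (fun x => x `^ t)%R S)%E) ->
  hausdorff_dim S = +oo%E.
Proof.
move=> St; apply/ereal_inf_pinfty => _ [t [t0 /eqP H0] <-].
by have := St t t0; rewrite lt_neqAle eq_sym H0.
Qed.

Lemma powR_gauge_homo (R : realType) (t x y : R) :
  0 <= t -> 0 < x -> x <= y -> x `^ t <= y `^ t.
Proof.
by move=> t0 x0 xy; apply: ge0_ler_powR => //; rewrite nnegrE ltW// (lt_le_trans x0).
Qed.

(** With a large base T, put M_k = T^(b^k), q_k = T^(2 b^k) and N_k = M_k^d.  The
    vectors of level k have norm O(M_k), so the tail beyond k is of order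
    M_(k+1) / q_(k+1) = T^(- b^(k+1)), which is small against q_k^(-s) =
    T^(- 2 s b^k) as b > 2 s.  The mass condition compares q_(k+1)^t =
    T^(2 t b b^k) with N_k = T^(d b^k), whence d > 2 t b. *)
Lemma hausdorff_WA_power (R : realType) (X : completeNormedModType R)
    (L : set X) (s t : R) :
  infinite_dimensional X -> is_lattice L -> 0 <= s -> 0 <= t ->
  (0 < hausdorff_measure (fun x => x `^ t)%R
     (WA (Qlat L) (Hstd L) (fun q => q `^ (- s))%R))%E.
Proof.
have exp1 i j : (0 < j)%N -> ((2 * j).+1 <= (2 * i + 4) * j)%N by nia.
have exp2 i j : (0 < j)%N -> ((2 * j * i + j).+1 <= (2 * i + 4) * j)%N by nia.
have exp3 i j l : (2 * (i * j) * l <= j * (2 * l * i).+1)%N by nia.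
move=> Xinf LL s0 t0.
have [lam lam0 Lsep] := lattice_separated LL.
pose m := Num.bound s; pose m' := Num.bound t.
have sm : s <= m%:R by exact/ltW/archi_boundP.
have tm : t <= m'%:R by exact/ltW/archi_boundP.
pose b := (2 * m + 4)%N; pose d := (2 * m' * b).+1.
have [D D0 growth] := lattice_growth d Xinf LL.
pose E0 := D + lam.
have E00 : 0 < E0 by rewrite addr_gt0.
have E0ge := ltW E00; have lamge := ltW lam0.
pose T := maxn 2 (Num.bound (8 * E0 / lam + 4 * E0)).
have T2 : (2 <= T)%N by rewrite leq_maxl.
have T0 : (0 < T)%N by rewrite ltnW.
have TE : 8 * E0 / lam + 4 * E0 <= T%:R.
  apply/ltW/(lt_le_trans (archi_boundP _)); last by rewrite ler_nat leq_maxr.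
  by rewrite addr_ge0 ?divr_ge0 ?mulr_ge0.
have TE1 : 8 * E0 <= lam * T%:R.
  have : 8 * E0 / lam <= T%:R by apply: le_trans TE; rewrite lerDl mulr_ge0.
  by rewrite ler_pdivrMr// [lam * _]mulrC.
have TE2 : 4 * E0 <= T%:R.
  by apply: le_trans TE; rewrite lerDr divr_ge0 ?mulr_ge0.
pose n k := (b ^ k)%N.
pose M k := (T ^ n k)%N; pose q k := (T ^ (2 * n k))%N.
have M0 k : (0 < M k)%N by rewrite expn_gt0 T0.
have q0 k : (0 < q k)%N by rewrite expn_gt0 T0.
have nS k : n k.+1 = (b * n k)%N by rewrite /n expnS.
have kn k : (k < n k)%N by apply: ltn_expl; rewrite /b addn4.
have [g gP] := choice (fun k => growth (M k) (M0 k)).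
have MT k : (T <= M k)%N.
  by rewrite -[leqLHS]expn1 leq_exp2l// (leq_trans _ (kn k)).
have Eq k : E0 * (M k)%:R / (q k)%:R = E0 / (M k)%:R.
  rewrite /q mul2n -addnn expnD natrM invfM mulrA mulfK//.
  by rewrite pnatr_eq0 -lt0n.
pose c := (lam / 2) `^ t.
apply: (@lt_le_trans _ _ c%:E); first by rewrite lte_fin powR_gt0// divr_gt0.
apply: (@hausdorff_WA_ge _ _ _ _ _ lam _ q (fun k => M k ^ d)%N g
  (fun k => E0 * (M k)%:R)) => //.
- by move=> x x0; exact: powR_gt0.
- move=> x y x0 xy; rewrite !powRN lef_pV2 ?posrE ?powR_gt0//.
    exact: powR_gauge_homo.
  exact: lt_le_trans xy.
- by move=> x x0; exact: powR_gt0.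
- by move=> x y; exact: powR_gauge_homo.
- by move=> k; rewrite dvdn_exp2l// leq_mul2l/= nS leq_pmull// addn4.
- move=> k; rewrite (leq_trans T2)// (leq_trans (MT k))//.
  by rewrite -[leqLHS]expn1 leq_exp2l// (leq_trans T2).
- move=> k j jM; have [gL _] := gP k; have [Lg gD] := gL j jM; split=> //.
  by rewrite (le_trans gD)// ler_wpM2r// lerDl ltW.
- by move=> k i j; have [_] := gP k; apply.
- move=> k; apply: (@le_trans _ _ E0); first by rewrite lerDr ltW.
  by rewrite ler_peMr ?ler1n.
- move=> k; rewrite Eq mulrA ler_pdivrMr ?ltr0n// mulrAC ler_pdivlMr ?ltr0n//.
  have TqM : (T * q k <= M k.+1)%N.
    by rewrite -expnS leq_exp2l// nS exp1// (leq_trans _ (kn k)).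
  apply: (@le_trans _ _ (lam * (T * q k)%:R)); last by rewrite ler_pM2l ?ler_nat.
  by rewrite natrM mulrA ler_wpM2r.
- move=> k; rewrite Eq powRN.
  have qm : (q k)%:R `^ s <= (q k ^ m)%:R :> R.
    by rewrite natrX -powR_mulrn// ler_powR// ler1n.
  have qs0 : 0 < (q k)%:R `^ s by rewrite powR_gt0// ltr0n.
  (* One factor T^(b^k) of M_(k+1) absorbs k + 1, another the constant T. *)
  have TqM : (T * (q k ^ m * k.+1) <= M k.+1)%N.
    apply: (@leq_trans (T * (q k ^ m * T ^ n k))); last first.
      by rewrite -expnM -expnD -expnS leq_exp2l// nS exp2// (leq_trans _ (kn k)).
    rewrite !leq_mul2l; apply/orP; right; apply/orP; right.
    by apply: leq_trans (kn k) _; apply/ltnW/ltn_expl.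
  rewrite mulrA ltr_pdivrMr ?ltr0n// -invfM [X in _ < X]mulrC.
  rewrite ltr_pdivlMr ?mulr_gt0 ?ltr0n//.
  have z0 : 0 < (q k ^ m * k.+1)%:R :> R by rewrite ltr0n muln_gt0 expn_gt0 q0.
  apply: (@le_lt_trans _ _ (2 * E0 * (q k ^ m * k.+1)%:R)).
    by rewrite ler_pM2l ?mulr_gt0// natrM ler_pM2r ?ltr0n.
  apply: (@lt_le_trans _ _ (T%:R * (q k ^ m * k.+1)%:R)).
    by rewrite ltr_pM2r//; lra.
  by rewrite -natrM ler_nat.
- by rewrite powR_gt0// divr_gt0.
move=> k; set x := lam / 2 / _.
have x0 : 0 < x by rewrite !divr_gt0// ltr0n.
rewrite (_ : c = x `^ t * (q k.+1)%:R `^ t).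
  rewrite ler_pM2l ?powR_gt0//.
  have qm : (q k.+1)%:R `^ t <= (q k.+1 ^ m')%:R :> R.
    by rewrite natrX -powR_mulrn// ler_powR// ler1n.
  apply: (le_trans qm); rewrite ler_nat -!expnM leq_exp2l// nS; exact: exp3.
by rewrite -powRM ?(ltW x0)// /x divfK// gt_eqF// ltr0n.
Qed.

Unset Implicit Arguments.

Theorem theorem3p6 (R : realType) (X : completeNormedModType R) (L : set X)
    (X_infdim : infinite_dimensional X)
    (L_lattice : is_lattice L)
    (L_noncobounded : ~ cobounded L) :
  (forall s : R, 0 <= s ->
     hausdorff_dim (WA (Qlat L) (Hstd L) (fun q : R => q `^ (- s))) = +oo%E) /\
  (~ strongly_discrete L ->
   forall psi : R -> R,
     (forall q, 0 < q -> 0 < psi q) ->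
     (forall q1 q2, 0 < q1 -> q1 <= q2 -> psi q2 <= psi q1) ->
     psi q @[q --> +oo] --> (0 : R) ->
     hausdorff_dim (WA (Qlat L) (Hstd L) psi) = +oo%E /\
     forall f : R -> R,
       (forall t, 0 < t -> 0 < f t) ->
       (forall t1 t2, 0 < t1 -> t1 <= t2 -> f t1 <= f t2) ->
       hausdorff_measure f (WA (Qlat L) (Hstd L) psi) = +oo%E).

Proof.
split=> [s s0|Lnsd psi psi0 psiM _].
  by apply: hausdorff_dim_pinfty => t t0; exact: hausdorff_WA_power.
split=> [|f f0 fM]; last exact: hausdorff_WA_not_strongly_discrete.
apply: hausdorff_dim_pinfty => t t0.
rewrite (hausdorff_WA_not_strongly_discrete L_lattice Lnsd psi0 psiM) ?ltry//.
  by move=> x x0; exact: powR_gt0.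
by move=> x y; exact: powR_gauge_homo.
Qed.
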